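(* For all positive integers $p,q$ with $p\geq q$, the covering radius of the natural $(p,q)$-type group $G_{p,q}\subseteq S_{p+q}$ with respect to the $l_\infty$-metric is $$r(G_{p,q})= p+\left\lfloor \left(\sqrt{q+\frac{1}{8}}-\frac{\sqrt{2}}{2}\right)^2-\frac{1}{8} \right\rfloor.$$
   Context: For a positive integer $n$, $[n]=\{1,\dots,n\}$ and $S_n$ is the symmetric group on $[n]$. The $l_\infty$-metric on $S_n$ is $d(f,g)=\max_{i\in[n]}|f(i)-g(i)|$. For a nonempty $C\subseteq S_n$ and $f\in S_n$, $d(f,C)=\min_{g\in C}d(f,g)$. The covering radius $r(C)$ is the minimum integer $r$ such that $d(f,C)\le r$ for all $f\in S_n$. For positive integers $p,q$, the natural $(p,q)$-type group is the subgroup $G_{p,q}=\langle(1,2,\dots,p),(p+1,p+2,\dots,p+q)\rangle\subseteq S_{p+q}$ generated by the two displayed cycles (cycle notation, where each entry is mapped to the next one and the last to the first; a cycle of length one is the identity). *)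

(* Defs.v *)
From HB Require Import structures.
From mathcomp Require Import all_boot all_order all_algebra all_fingroup.
From mathcomp Require Import zify reals.

Set Implicit Arguments.
Unset Strict Implicit.
Unset Printing Implicit Defensive.

Import Order.TTheory GRing.Theory Num.Theory.

(* Permutations of {1, ..., n} are rendered as permutations of                *)
(* 'I_n = {0, ..., n - 1}; shifting all indices by one does not change any    *)
(* distance. *)
Definition linf_dist (n : nat) (f g : 'S_n) : nat :=
  \max_(i < n) `|((f i)%:Z - (g i)%:Z)%R|%N.

(* All values of linf_dist on 'S_n are at most n, so the neutral element n is *)
(* irrelevant when C is nonempty: see dist_set_attained and dist_set_le. *)
Definition dist_set (n : nat) (f : 'S_n) (C : {set 'S_n}) : nat :=
  \big[minn/n]_(g in C) linf_dist f g.

Lemma linf_dist_le (n : nat) (f g : 'S_n) : linf_dist f g <= n.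
Proof.
apply/bigmax_leqP => i _.
by have := ltn_ord (f i); have := ltn_ord (g i); lia.
Qed.

Lemma dist_set_le (n : nat) (f g : 'S_n) (C : {set 'S_n}) :
  g \in C -> dist_set f C <= linf_dist f g.
Proof.
move=> gC; rewrite /dist_set; have := mem_index_enum g.
rewrite unlock; elim: (index_enum _) => //= h s IH; rewrite inE.
case/predU1P => [<-|/IH le_s]; first by rewrite gC geq_minl.
by case: ifP => // _; rewrite (leq_trans (geq_minr _ _)).
Qed.

Lemma dist_set_attained (n : nat) (f : 'S_n) (C : {set 'S_n}) :
  C != set0 -> exists2 g, g \in C & dist_set f C = linf_dist f g.
Proof.
case/set0Pn => g0 g0C.
have : dist_set f C = n \/ exists2 g, g \in C & dist_set f C = linf_dist f g.
  rewrite /dist_set; elim/big_ind: _ => [|x y hx hy|g gC]; first by left.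
    by rewrite /minn; case: ifP.
  by right; exists g.
case=> // e; exists g0 => //; apply/eqP.
by rewrite eqn_leq dist_set_le //= e linf_dist_le.
Qed.

Lemma covering_radius_subproof (n : nat) (C : {set 'S_n}) :
  exists r : nat, [forall f : 'S_n, dist_set f C <= r].
Proof.
exists (\max_(f : 'S_n) dist_set f C); apply/forallP => f.
exact: (leq_bigmax f).
Qed.

Definition covering_radius (n : nat) (C : {set 'S_n}) : nat :=
  ex_minn (covering_radius_subproof C).

(* For a duplicate-free sequence s = [:: x_1; ...; x_k], the cycle            *)
(* (x_1, ..., x_k): next s sends x_i to x_{i+1}, x_k to x_1, and fixes every  *)
(* point outside s. *)
Definition cycle_perm (T : finType) (s : seq T) (Us : uniq s) : {perm T} :=
  perm (can_inj (prev_next Us)).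

Lemma uniq_lshift (p q : nat) : uniq [seq lshift q i | i <- enum 'I_p].
Proof. by rewrite (map_inj_uniq (@lshift_inj p q)) enum_uniq. Qed.

Lemma uniq_rshift (p q : nat) : uniq [seq rshift p j | j <- enum 'I_q].
Proof. by rewrite (map_inj_uniq (@rshift_inj p q)) enum_uniq. Qed.

(* The generators are the cycles on the first p points (in increasing order)  *)
(* and on the last q points of 'I_(p + q). *)
Definition natural_group (p q : nat) : {group 'S_(p + q)} :=
  <<[set cycle_perm (uniq_lshift p q); cycle_perm (uniq_rshift p q)]>>%G.

(* Main.v *)
(* With [m] determined by ['C(m, 2) < q <= 'C(m.+1, 2)], the radius is        *)
(* [p + q - m].  A shift pair [(a, b)] is too far from [f] only if some       *)
(* position gets from [f] one of the values [u], [p + q - 1 - v] with         *)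
(* [u + v <= m - 2] and from the shift the other one.  As [m <= q <= p], a    *)
(* shift of one block takes only one of these extreme values, so each pair    *)
(* [(u, v)] rules out at most one [a] and at most one [b]; there are          *)
(* ['C(m, 2) < q] pairs, so some [(a, b)] survives.  Conversely, if one allows*)
(* [u + v <= m - 1], there are ['C(m.+1, 2) >= q] pairs, enough for a suitable*)
(* [f] to rule out every [b].                                                 *)

Require Import Defs.
From HB Require Import structures.
From mathcomp Require Import all_boot all_order all_algebra all_fingroup.
From mathcomp Require Import reals.
From mathcomp Require Import zify ring lra.

Set Implicit Arguments.
Unset Strict Implicit.
Unset Printing Implicit Defensive.

Import Order.TTheory GRing.Theory Num.Theory.

(** The counting above is [exists_far_choice], applied once to each block in
    [natural_group_radius_ub]; this is possible because [natural_groupP] lets [a] and [b] vary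
    independently. Its sharpness is shown by the explicit [f] of [natural_group_radius_lb]. The
    closed form enters only through [floor_triangular_root]: up to a change of form, the floor
    solves the quadratic inequalities that define [m]. *)

(** * Triangular numbers and finite combinatorics *)

Lemma bin2S (l : nat) : 'C(l.+1, 2) = 'C(l, 2) + l.
Proof. by rewrite binS bin1. Qed.

Lemma triangular_root (c : nat) :
  exists2 l, 0 < l & 'C(l, 2) <= c < 'C(l.+1, 2).
Proof.
elim: c => [|c [l l0 /andP[h1 h2]]]; first by exists 1.
have [lt_c|ge_c] := ltnP c.+1 'C(l.+1, 2).
  by exists l => //; rewrite lt_c (leq_trans h1).
by exists l.+1 => //; rewrite ge_c (bin2S l.+1); lia.
Qed.

Lemma triangular_root_leq (c k l : nat) :
  'C(l, 2) <= c -> c < 'C(k.+1, 2) -> l <= k.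
Proof.
move=> h1 h2; rewrite leqNgt; apply/negP => /(leq_bin2l 2) h3.
by have := leq_trans h2 (leq_trans h3 h1); rewrite ltnn.
Qed.

Lemma bin2_inj (k l : nat) : 0 < k -> 0 < l -> 'C(k, 2) = 'C(l, 2) -> k = l.
Proof.
move=> k0 l0 e; apply/eqP; rewrite eqn_leq.
by apply/andP; split; apply: (@triangular_root_leq 'C(k, 2));
  rewrite ?bin2S ?e //; lia.
Qed.

Lemma exists_perm_extension (T : finType) (k : nat) (u v : nat -> T) :
  {in gtn k &, injective u} -> {in gtn k &, injective v} ->
  exists s : {perm T}, forall i, i < k -> s (u i) = v i.
Proof.
elim: k => [|k IH] uI vI; first by exists 1%g.
have [||s sE] := IH.
- by move=> i j hi hj; apply: uI; rewrite inE ltnW.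
- by move=> i j hi hj; apply: vI; rewrite inE ltnW.
(* The transposition corrects the image of [u k]; injectivity of [u] and [v] keeps the earlier
   images [v i] away from both points it moves. *)
exists (s * tperm (s (u k)) (v k))%g => i; rewrite ltnS leq_eqVlt permM.
case/predU1P => [->|lt_ik]; first by rewrite tpermL.
have ne_ik : i != k by rewrite neq_ltn lt_ik.
rewrite -(sE i lt_ik) tpermD //.
  by apply: contra_neq ne_ik => /perm_inj/esym; apply: uI; rewrite inE // ltnW.
rewrite sE //; apply: contra_neq ne_ik => /esym.
by apply: vI; rewrite inE // ltnW.
Qed.

(* The colliding [a] inject into the pairs [(h i, c i a)], of which there are *)
(* only ['C(m, 2)] with sum at most [m - 2].                                  *)
Lemma exists_far_choice (I A : finType) (m : nat) (h : I -> nat)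
    (c : I -> A -> nat) :
  injective h -> (forall i, injective (c i)) -> 'C(m, 2) < #|A| ->
  exists a, forall i, m <= (h i + c i a).+1.
Proof.
move=> hI cI lt_mA.
pose B (u : nat) := [set a | [exists i, (h i == u) && ((u + c i a).+1 < m)]].
(* At most one [i] has [h i = u], and [c i] maps [B u] injectively into the numbers below
   [m.-1 - u]. *)
have card_B u : #|B u| <= m.-1 - u.
  have [i /eqP hi|noi] := pickP (fun i => h i == u); last first.
    suff -> : B u = set0 by rewrite cards0.
    apply/setP => a; rewrite !inE; apply/existsP => -[i].
    by rewrite noi.
  have Bc a : a \in B u -> c i a < m.-1 - u.
    rewrite inE => /existsP[j /andP[/eqP hj]].
    by have -> : j = i by [apply: hI; rewrite hi hj]; lia.
  rewrite -(size_iota 0 (m.-1 - u)) cardE -(size_map (c i)).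
  apply: uniq_leq_size; first by rewrite (map_inj_uniq (@cI i)) enum_uniq.
  by move=> _ /mapP[a aB ->]; rewrite mem_iota add0n Bc // -mem_enum.
have card_U : #|\bigcup_(u < m.-1) B u| <= 'C(m, 2).
  apply: leq_trans (_ : \sum_(u < m.-1) (m.-1 - u) <= _).
    elim/big_ind2: _ => [|X kX Y kY hX hY|u _]; rewrite ?cards0 //.
    by rewrite (leq_trans (leq_card_setU _ _)) ?leq_add.
  case: m {B card_B lt_mA} => [|m] /=; first by rewrite big_ord0.
  rewrite -bin2_sum big_mkord big_ord_recl add0n (reindex_inj rev_ord_inj) /=.
  by apply/eq_leq/eq_bigr => u _ /=; rewrite /bump; have := ltn_ord u; lia.
have [a aNU] : exists a, a \notin \bigcup_(u < m.-1) B u.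
  apply/existsP; rewrite -negb_forall; apply: contraTN lt_mA => /forallP allU.
  rewrite -leqNgt (leq_trans _ card_U) // -cardsT subset_leq_card //.
  by apply/subsetP => a _.
exists a => i; rewrite leqNgt; apply: contra aNU => lt_m.
have lt_h : h i < m.-1 by lia.
apply/bigcupP; exists (Ordinal lt_h) => //=.
by rewrite inE; apply/existsP; exists i; rewrite eqxx.
Qed.

Lemma covering_radius_eq (n : nat) (C : {set 'S_n}) (r : nat) :
  (forall f, dist_set f C <= r) -> (exists f, r <= dist_set f C) ->
  covering_radius C = r.
Proof.
move=> up [f lo]; rewrite /covering_radius;
case: ex_minnP => k /forallP kP kmin.
apply/eqP; rewrite eqn_leq (leq_trans lo) // kmin //.
exact/forallP.
Qed.

(** * Cyclic shifts and the elements of the group *)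

Lemma ltn_mod_ord (N : nat) (i : 'I_N) (k : nat) : k %% N < N.
Proof. by rewrite ltn_pmod // (leq_ltn_trans _ (ltn_ord i)). Qed.

Lemma modn_shift_inj (N i : nat) :
  injective (fun a : 'I_N => (i + a) %% N).
Proof.
move=> a b /eqP; rewrite eqn_modDl => /eqP.
by rewrite !modn_small // => /val_inj.
Qed.

Lemma next_enum_ord (p : nat) (i : 'I_p) :
  next (enum 'I_p) i = i.+1 %% p :> nat.
Proof.
rewrite -(next_map val_inj (enum_uniq _)) val_enum_ord next_nth.
case: p i => [[] //|p] i; have lt_ip := ltn_ord i.
have -> : index (i : nat) (iota 0 p.+1) = i.
  rewrite -[X in index X](nth_iota 0 0 lt_ip).
  by rewrite index_uniq ?iota_uniq ?size_iota.
rewrite mem_iota ltn_ord /=.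
(* The successor is read off the tail of the list; for the last index the read runs past the end and
   its default, the head 0, gives the wrap-around. *)
have [lt_i|ge_i] := ltnP i p; first by rewrite nth_iota // modn_small.
have -> : i = p :> nat by lia.
by rewrite nth_default ?size_iota // modnn.
Qed.

Section NaturalGroup.
Variables p q : nat.
Let x := cycle_perm (uniq_lshift p q).
Let y := cycle_perm (uniq_rshift p q).

Lemma lcycle_lshift (a : nat) (i : 'I_p) :
  (x ^+ a)%g (lshift q i) = (i + a) %% p :> nat.
Proof.
suff [j -> <-] : exists2 j : 'I_p, (x ^+ a)%g (lshift q i) = lshift q j
  & j = (i + a) %% p :> nat by [].
elim: a => [|a [j xj ja]].
  by exists i; rewrite ?expg0 ?perm1 // addn0 modn_small.
exists (next (enum 'I_p) j).
  by rewrite expgSr permM xj permE next_map ?enum_uniq //; apply: lshift_inj.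
by rewrite next_enum_ord ja -addn1 modnDml addn1 addnS.
Qed.

Lemma rcycle_rshift (b : nat) (j : 'I_q) :
  (y ^+ b)%g (rshift p j) = p + (j + b) %% q :> nat.
Proof.
suff [k -> <-] : exists2 k : 'I_q, (y ^+ b)%g (rshift p j) = rshift p k
  & k = (j + b) %% q :> nat by [].
elim: b => [|b [k yk kb]].
  by exists j; rewrite ?expg0 ?perm1 // addn0 modn_small.
exists (next (enum 'I_q) k).
  by rewrite expgSr permM yk permE next_map ?enum_uniq //; apply: rshift_inj.
by rewrite next_enum_ord kb -addn1 modnDml addn1 addnS.
Qed.

Lemma lcycle_rshift (a : nat) (j : 'I_q) : (x ^+ a)%g (rshift p j) = rshift p j.
Proof.
elim: a => [|a IH]; first by rewrite expg0 perm1.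
rewrite expgSr permM IH permE next_nth; case: ifP => // /mapP[i _ /eqP].
by rewrite eq_rlshift.
Qed.

Lemma rcycle_lshift (b : nat) (i : 'I_p) : (y ^+ b)%g (lshift q i) = lshift q i.
Proof.
elim: b => [|b IH]; first by rewrite expg0 perm1.
rewrite expgSr permM IH permE next_nth; case: ifP => // /mapP[j _ /eqP].
by rewrite eq_lrshift.
Qed.

(** The generators have disjoint supports, hence commute, so the group they generate is the product
    of the two cyclic groups. *)
Lemma natural_groupP (g : 'S_(p + q)) :
  reflect (exists a b, g = (x ^+ a * y ^+ b)%g) (g \in natural_group p q).
Proof.
have xy : commute x y.
  apply/permP => k; rewrite !permM -(expg1 x) -(expg1 y).
  have [i -> {k}|j -> {k}] := split_ordP k.
    rewrite rcycle_lshift.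
    have [j ->|j e] := split_ordP ((x ^+ 1)%g (lshift q i)).
      by rewrite rcycle_lshift.
    have := lcycle_lshift 1 i; rewrite e /=.
    by have := ltn_mod_ord i (i + 1); lia.
  rewrite lcycle_rshift.
  have [i e|i ->] := split_ordP ((y ^+ 1)%g (rshift p j)).
    by have := rcycle_rshift 1 j; rewrite e /=; have := ltn_ord i; lia.
  by rewrite lcycle_rshift.
have -> : natural_group p q = (<[x]> * <[y]>)%g :> {set _}.
  rewrite -cent_joinEr; first by rewrite joing_idl joing_idr.
  rewrite cycle_subG; apply/centP => _ /cycleP[a ->].
  exact/commuteX/commute_sym.
apply: (iffP mulsgP) => [[_ _ /cycleP[a ->] /cycleP[b ->] ->]|[a [b ->]]].
  by exists a, b.
by exists (x ^+ a)%g (y ^+ b)%g; rewrite ?mem_cycle.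
Qed.

Lemma natural_group_lshift (a b : nat) (i : 'I_p) :
  (x ^+ a * y ^+ b)%g (lshift q i) = (i + a) %% p :> nat.
Proof.
rewrite permM; have := lcycle_lshift a i.
have [j ->|j -> /= e] := split_ordP ((x ^+ a)%g (lshift q i)).
  by rewrite rcycle_lshift.
have := ltn_mod_ord i (i + a); lia.
Qed.

Lemma natural_group_rshift (a b : nat) (j : 'I_q) :
  (x ^+ a * y ^+ b)%g (rshift p j) = p + (j + b) %% q :> nat.
Proof. by rewrite permM lcycle_rshift rcycle_rshift. Qed.

(** * The two bounds on the radius *)

Lemma natural_group_radius_ub (m : nat) (f : 'S_(p + q)) :
  q <= p -> m <= q -> 'C(m, 2) < q ->
  dist_set f (natural_group p q) <= p + q - m.
Proof.
move=> le_qp le_mq lt_mq.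
(* In the first block the danger is a value of [f] near the top against a shift near 0; in the
   second block the roles are exchanged. *)
have [a aP] : exists a : 'I_p, forall i : 'I_p,
    m <= (((p + q).-1 - f (lshift q i)) + (i + a) %% p).+1.
  apply: (@exists_far_choice 'I_p 'I_p m
           (fun i => (p + q).-1 - f (lshift q i)) (fun i a => (i + a) %% p)).
  - move=> i j e; apply: (@lshift_inj p q); apply: (@perm_inj _ f).
    apply: val_inj => /=.
    have := ltn_ord (f (lshift q i)); have := ltn_ord (f (lshift q j)); lia.
  - by move=> i; apply: modn_shift_inj.
  - by rewrite card_ord (leq_trans lt_mq).
have [b bP] : exists b : 'I_q, forall j : 'I_q,
    m <= (f (rshift p j) + (q.-1 - (j + b) %% q)).+1.
  apply: (@exists_far_choice 'I_q 'I_q m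
           (fun j => f (rshift p j)) (fun j b => q.-1 - (j + b) %% q)).
  - by move=> i j /val_inj/perm_inj/rshift_inj.
  - move=> j b b' e; apply: (@modn_shift_inj q j).
    have := ltn_mod_ord j (j + b).
    have := ltn_mod_ord j (j + b').
    rewrite /=; lia.
  - by rewrite card_ord.
apply: leq_trans (dist_set_le f (_ : (x ^+ a * y ^+ b)%g \in _)) _.
  by apply/natural_groupP; exists a, b.
(* Differences of the opposite sign are at most [p - 1] and [q - 1], both below [p + q - m] since
   [m <= q <= p]. *)
apply/bigmax_leqP => k _; have [i ->|j ->] := split_ordP k.
  rewrite natural_group_lshift; move: (aP i) (ltn_ord (f (lshift q i))).
  by have := ltn_mod_ord i (i + a); lia.
rewrite natural_group_rshift; move: (bP j) (ltn_ord (f (rshift p j))).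
by have := ltn_mod_ord j (j + b); lia.
Qed.

(* Sending position [p + 'C(l, 2)] to the value [m - l], for [1 <= l <= m],   *)
(* rules out [l] consecutive shifts of the second block; since                *)
(* ['C(l, 2) + l = 'C(l.+1, 2)] these runs tile all the shifts.               *)
Lemma natural_group_radius_lb (m : nat) :
  m <= q -> 'C(m, 2) < q <= 'C(m.+1, 2) ->
  exists f, p + q - m <= dist_set f (natural_group p q).
Proof.
move=> le_mq /andP[lt_mq le_qm].
have lt_bin l : l < m -> 'C(l.+1, 2) < q.
  by move=> lt_lm; apply: leq_ltn_trans lt_mq; apply: leq_bin2l.
have q0 : 0 < q by apply: leq_ltn_trans lt_mq.
have lt_val l : m - l.+1 < p + q by lia.
(* The default of [insubd] is never reached: [lt_bin] keeps the index below [q] for [l < m]. *)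
pose u l := rshift p (insubd (Ordinal q0) 'C(l.+1, 2)).
pose v l := Ordinal (lt_val l).
have [||f fE] := @exists_perm_extension 'I_(p + q) m u v.
- move=> k l; rewrite !inE => hk hl /rshift_inj/(congr1 val).
  by rewrite !val_insubd !lt_bin // => /bin2_inj-/(_ isT isT)[].
- by move=> k l; rewrite !inE => hk hl /(congr1 val) /=; lia.
exists f; have [|g /natural_groupP[a [b ->]] ->] :=
  @dist_set_attained _ f (natural_group p q).
  by apply/set0Pn; exists 1%g; apply: group1.
(* [c] is the position in the second block that the shift sends to the top value. A position
   [j <= c] does not wrap and lands [c - j] below the top; the triangular root of [c] gives such a
   [j] with [c - j <= l], which the value [m - l.+1] of [f] compensates. *)
pose c := q.-1 - b %% q.
have [[//|l] _ /andP[le_lc lt_cl]] := triangular_root c.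
have lt_bq := ltn_pmod b q0.
have lt_cq : c < q by rewrite /c; lia.
have lt_lm : l < m by apply: (triangular_root_leq le_lc); lia.
apply: leq_trans (leq_bigmax (u l)).
rewrite fE // natural_group_rshift val_insubd lt_bin //= -modnDmr.
rewrite modn_small; last by rewrite /c in le_lc; lia.
by rewrite (bin2S l.+1) /c in lt_cl le_lc *; lia.
Qed.

End NaturalGroup.

(** * The closed form *)

Local Open Scope ring_scope.

Lemma floor_triangular_root (R : realType) (q m : nat) :
  (0 < m)%N -> ('C(m, 2) < q <= 'C(m.+1, 2))%N ->
  Num.floor ((Num.sqrt (q%:R + 1 / 8 : R) - Num.sqrt 2 / 2) ^+ 2 - 1 / 8) =
  q%:Z - m%:Z.
Proof.
move=> m0 /andP[lo up].
have dbl : ('C(m, 2) * 2 + m = m * m)%N.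
  by elim: (m) => // k IH; rewrite bin2S; lia.
have {lo} lo : (m%:R * m%:R - m%:R + 1 <= 2 * q%:R :> R).
  have : (m * m + 2 <= 2 * q + m)%N by lia.
  rewrite -(ler_nat R) !natrD !natrM; lra.
have {up} up : (2 * q%:R <= m%:R * m%:R + m%:R :> R).
  have : (2 * q <= m * m + m)%N by rewrite bin2S in up; lia.
  by rewrite -(ler_nat R) !natrD !natrM; lra.
have m1 : 1 <= m%:R :> R by rewrite ler1n.
have q0 : 0 <= q%:R :> R by [].
set s := Num.sqrt _; set t := Num.sqrt 2.
have s2 : s * s = q%:R + 1 / 8 by rewrite -expr2 sqr_sqrtr //; lra.
have t2 : t * t = 2 by rewrite -expr2 sqr_sqrtr //; lra.
have st0 : 0 <= s * t by rewrite mulr_ge0 ?sqrtr_ge0.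
have st2 : (s * t) * (s * t) = 2 * q%:R + 1 / 4.
  by rewrite mulrACA s2 t2; lra.
have -> : (s - t / 2) ^+ 2 - 1 / 8 = q%:R + 1 / 2 - s * t.
  have -> : (s - t / 2) ^+ 2 = s * s - s * t + (t * t) / 4 by field.
  by rewrite s2 t2; lra.
(* Both bounds amount to [m - 1/2 < s * t <= m + 1/2]; squared, with [st2], this is
   [m(m - 1) < 2q <= m(m + 1)]. *)
apply: floor_def; rewrite [(_ + 1)%:~R]intrD intrB -!pmulrn.
by apply/andP; split; nra.
Qed.

Theorem mainTheorem1 (R : realType) (p q : nat)
    (hp : (0 < p)%N) (hq : (0 < q)%N) (hpq : (q <= p)%N) :
  (covering_radius (natural_group p q))%:Z =
  p%:Z + Num.floor ((Num.sqrt (q%:R + 1 / 8 : R) - Num.sqrt 2 / 2) ^+ 2 - 1 / 8).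
Proof.
have [m m0] := triangular_root q.-1; rewrite -ltnS -(leq_add2r 1) !addn1.
rewrite prednK // ltnS => mP; have /andP[lo up] := mP.
have le_mq : (m <= q)%N.
  case: m m0 lo {mP up} => // -[|k] _ //.
  by rewrite bin2S; lia.
rewrite (floor_triangular_root R m0 mP).
have -> : covering_radius (natural_group p q) = (p + q - m)%N.
  apply: covering_radius_eq => [f|]; first exact: natural_group_radius_ub.
  exact: natural_group_radius_lb.
lia.
Qed.
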